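(* Let $G$ be a connected graph on $n$ vertices, and let $J(G)$ be its cover ideal. Then: (1) For every positive integer $c$, $J(G)^{(2r-2c)} \subset J(G)^r$ for every integer $r \geq c\,\chi(G)$. (2) For every positive integer $c$, $J(G)^{(2r-2c-1)} \subset J(G)^r$ for every integer $r \geq c\,\chi(G)+1$. (3) $\displaystyle \max\left\{ 2-\frac{2}{\omega(G)},\ 2 - \frac{2\alpha(G)}{n} \right\} \leq \rho_a(J(G)) \leq \rho(J(G)) \leq 2-\frac{2}{\chi(G)}.$
   Context: All graphs are finite and simple, with no isolated vertices. $\chi(G)$ is the chromatic number, $\omega(G)$ the clique number, and $\alpha(G)$ the independence number (maximum size of an independent set) of $G$. If $V(G)=\{x_1,\dots,x_n\}$ and $\mathbb{K}$ is a field, the cover ideal $J(G)\subset\mathbb{K}[x_1,\dots,x_n]$ is the ideal generated by the monomials $\prod_{x\in\Gamma}x$, $\Gamma$ a vertex cover of $G$; equivalently $J(G)=\bigcap_{\{x_i,x_j\}\in E(G)}(x_i,x_j)$. For an ideal $I$ in a Noetherian ring $R$, $I^{(s)}=\bigcap_{P\in\mathrm{Ass}(I)}(I^sR_P\cap R)$ is the $s$-th symbolic power. The resurgence and asymptotic resurgence are $\rho(I)=\sup\{s/t : s,t\in\mathbb{N},\ I^{(s)}\not\subset I^t\}$ and $\rho_a(I)=\sup\{s/t : s,t\in\mathbb{N},\ I^{(sr)}\not\subset I^{tr}\text{ for all } r\gg0\}$, where $\mathbb{N}$ denotes the positive integers. *)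

(* Defs.v *)
From HB Require Import structures.
From mathcomp Require Import all_boot all_order all_algebra.
From mathcomp Require Import ring_quotient mpoly.
From mathcomp Require Import boolp classical_sets reals constructive_ereal ereal.

Set Implicit Arguments.
Unset Strict Implicit.
Unset Printing Implicit Defensive.

Import Order.TTheory GRing.Theory Num.Theory.

Local Open Scope classical_set_scope.
Local Open Scope ring_scope.

Section Ideals.
Variable A : comNzRingType.
Implicit Types (S I J P : set A) (s t r : nat) (f : A).

Definition ideal_gen S : set A :=
  [set f | exists (k : nat) (a g : 'I_k -> A),
     (forall i, S (g i)) /\ f = \sum_i a i * g i].

Definition ideal_mul I J : set A :=
  ideal_gen [set f | exists g h, [/\ I g, J h & f = g * h]].

Definition ideal_exp I s : set A := iter s (ideal_mul I) setT.

Definition prime_ideal P : Prop :=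
  idealr_closed (mem P) /\ prime_idealr_closed (mem P).

(* P is the annihilator of the class of some f in A / I. *)
Definition associated_prime I P : Prop :=
  prime_ideal P /\ exists f, P = [set g | I (g * f)].

(* The contraction to A of the extension of I to the localization A_P: the
   elements of that extension are the fractions a / u with a in I and u not in
   P, and f / 1 = a / u in A_P means v * (u * f) = v * a for some v not in P. *)
Definition local_contraction P I : set A :=
  [set f | exists a u v, [/\ I a, ~ P u, ~ P v & v * (u * f) = v * a]].

Definition symbolic_power I s : set A :=
  \bigcap_(P in associated_prime I) local_contraction P (ideal_exp I s).

(* Suprema are taken in the extended reals, so that no boundedness or
   nonemptiness of the sets is presupposed. *)
Definition resurgence (R : realType) I : \bar R :=
  ereal_sup [set x | exists s t : nat,
    [/\ (0 < s)%N, (0 < t)%N,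
        ~ (symbolic_power I s `<=` ideal_exp I t)
      & x = (s%:R / t%:R)%:E]].

Definition asymptotic_resurgence (R : realType) I : \bar R :=
  ereal_sup [set x | exists s t : nat,
    [/\ (0 < s)%N, (0 < t)%N,
        exists r0 : nat, forall r : nat, (r0 <= r)%N ->
          ~ (symbolic_power I (s * r) `<=` ideal_exp I (t * r))
      & x = (s%:R / t%:R)%:E]].

End Ideals.

Record sgraph (n : nat) := SGraph {
  edge :> rel 'I_n;
  edge_sym : ssrbool.symmetric edge;
  edge_irrefl : irreflexive edge
}.

Section Graphs.
Variables (n : nat) (G : sgraph n).
Implicit Types (C : {set 'I_n}) (k : nat).

Definition no_isolated_vertex : Prop := forall x, exists y, G x y.

Definition connected_graph : Prop :=
  (0 < n)%N /\ forall x y, connect G x y.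

Definition vertex_cover C : bool :=
  [forall x, forall y, G x y ==> (x \in C) || (y \in C)].

Definition is_clique C : bool :=
  [forall x in C, forall y in C, (x != y) ==> G x y].

Definition is_independent C : bool :=
  [forall x in C, forall y in C, ~~ G x y].

Definition clique_number : nat := (\max_(C : {set 'I_n} | is_clique C) #|C|)%N.

Definition independence_number : nat :=
  (\max_(C : {set 'I_n} | is_independent C) #|C|)%N.

Definition colorable k : bool :=
  [exists c : {ffun 'I_n -> 'I_k}, forall x, forall y, G x y ==> (c x != c y)].

Lemma colorable_ex : exists k, colorable k.
Proof.
exists n; apply/existsP; exists [ffun x => x].
apply/forallP => x; apply/forallP => y; apply/implyP; rewrite !ffunE.
by apply: contraTneq => ->; rewrite edge_irrefl.
Qed.

Definition chromatic_number : nat := ex_minn colorable_ex.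

Definition cover_ideal (K : fieldType) : set {mpoly K[n]} :=
  ideal_gen [set f | exists2 C : {set 'I_n},
    vertex_cover C & f = \prod_(i in C) 'X_i].

End Graphs.

Arguments cover_ideal {n} G K _ : assert.

(* Main.v *)
Require Import Defs.
From mathcomp Require Import all_boot all_order all_algebra.
From mathcomp Require Import ring_quotient mpoly.
From mathcomp Require Import boolp classical_sets reals constructive_ereal ereal.
From mathcomp Require Import zify ring lra.

(** Both kinds of powers of J = J(G) are monomial ideals, so every containment
    between them is a statement about exponent vectors m : V -> nat.
    - A monomial lies in the symbolic power J^(s) iff m is an s-cover, that is,
      m u + m v >= s on every edge uv ([multicover]).  The associated primes of
      J are the edge ideals (x_u, x_v), and the orders of vanishing along these
      primes are valuations ([weight_mul_cancel]).
    - A monomial lies in J^t iff m dominates a sum of t vertex covers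
      ([coverable], [cover_ideal_expE]).
    Hence J^(s) is contained in J^t iff every s-cover dominates a sum of t
    vertex covers ([symbolic_power_subP]).

    Upper bound.  A (2d+e)-cover with e <= 1 dominates a sum of d 2-covers
    and e 1-covers.  The combinatorial heart is [two_covers_to_covers]: with k+1 = chi
    colours, any k 2-covers together dominate k+1 vertex covers.  Handling the
    2-covers in groups of k = chi - 1 gains one vertex cover per group, so a
    (2d+e)-cover dominates d + d %/ k + e vertex covers ([multicover_coverable]).
    Both containments and the bound on the resurgence are arithmetic
    consequences of this count ([chromatic_containment]).

    Lower bound.  Let S be a vertex set that meets every independent set in at
    most b points.  Every vertex cover has at least #|S| - b vertices in S, while
    the vector with value N on S and 2N elsewhere is a 2N-cover of total weight
    N #|S| on S.  So this vector does not dominate t vertex covers as soon as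
    t (#|S| - b) > N #|S|, a condition preserved when N and t are multiplied by
    the same r; the resulting ratios 2N/t come arbitrarily close to
    2 - 2b/#|S| ([asymptotic_resurgence_ge]).  A maximum clique with b = 1 and
    the whole vertex set with b = alpha give the two terms of the maximum. *)

Set Implicit Arguments.
Unset Strict Implicit.
Unset Printing Implicit Defensive.

Import Order.TTheory GRing.Theory Num.Theory.

Local Open Scope ring_scope.

(** * Vertex covers and multicovers *)

Section Covers.
Variables (n : nat) (G : sgraph n).
Implicit Types (m g : 'I_n -> nat) (C : {set 'I_n}) (s t d e k : nat).

(** The exponent vectors of the monomials in the intersection of the ideals
    (x_u, x_v)^s over the edges uv. *)
Definition multicover s m : Prop := forall u v, G u v -> (s <= m u + m v)%N.

(** The exponent vectors of the monomials in the t-th power of the cover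
    ideal. *)
Definition coverable t m : Prop :=
  exists Cs : seq {set 'I_n},
    [/\ size Cs = t, all (vertex_cover G) Cs
      & forall v, (count (fun C => v \in C) Cs <= m v)%N].

Lemma vertex_coverP C :
  reflect (forall u v, G u v -> (u \in C) || (v \in C)) (vertex_cover G C).
Proof.
apply: (iffP 'forall_forallP) => covC u v; first exact/implyP.
by apply/implyP/covC.
Qed.

Lemma coverable_le t t' m m' : coverable t m -> (t' <= t)%N ->
  (forall v, (m v <= m' v)%N) -> coverable t' m'.
Proof.
move=> [Cs [szCs covCs leCs]] le_t le_m; exists (take t' Cs); split.
- by rewrite size_take_min szCs; apply/minn_idPl.
- by apply/allP => C /mem_take; exact: (allP covCs).
- move=> v; apply: leq_trans (le_m v); apply: leq_trans (leCs v).
  by rewrite -{2}(cat_take_drop t' Cs) count_cat leq_addr.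
Qed.

Lemma coverable0 m : coverable 0 m.
Proof. by exists [::]. Qed.

Lemma coverableD t t' m m' : coverable t m -> coverable t' m' ->
  coverable (t + t') (fun v => m v + m' v)%N.
Proof.
move=> [Cs [szCs covCs leCs]] [Ds [szDs covDs leDs]]; exists (Cs ++ Ds).
split; first by rewrite size_cat szCs szDs.
  by rewrite all_cat covCs.
by move=> v; rewrite count_cat leq_add.
Qed.

Lemma coverable_support m : multicover 1 m -> coverable 1 m.
Proof.
move=> mcov; exists [:: [set v | 0 < m v]%N]; split=> //=.
  rewrite andbT; apply/vertex_coverP => u v /mcov; rewrite !inE; lia.
by move=> v; rewrite inE addn0; case: (m v).
Qed.

(** Why k 2-covers pay for k+1 vertex covers.  The set C_i, i < k, collects the
    vertices where g_i is positive, except that a vertex of colour i is dropped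
    when g_i = 1 there: the vertices with g_i = 0 form an independent set whose
    neighbours all have g_i >= 2, and dropping part of one colour class keeps the
    complement independent.  Every inequality C_i <= g_i has slack where g_i >= 2
    and at the dropped vertices.  The vertices with slack for some i form D, which
    is a vertex cover: an edge that misses D has g_i = 1 at both ends for all i
    (otherwise one end would have g_i >= 2), hence both ends carry the
    last colour k, contradicting properness. *)
Lemma two_covers_to_covers k (c : 'I_n -> nat) (g : nat -> 'I_n -> nat) :
    (forall v, c v < k.+1)%N -> (forall u v, G u v -> c u != c v) ->
    (forall i, (i < k)%N -> multicover 2 (g i)) ->
  coverable k.+1 (fun v => \sum_(i < k) g i v)%N.
Proof.
move=> c_lt c_proper g_cov.
pose C i := [set v | (0 < g i v) && ((c v == i) ==> (1 < g i v))]%N.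
pose D := [set v | [exists i : 'I_k, (1 < g i v) || (c v == i) && (0 < g i v)]]%N.
have C_le i v : ((v \in C i) <= g i v)%N by rewrite inE; lia.
exists (D :: [seq C i | i <- iota 0 k]); split.
- by rewrite /= size_map size_iota.
- have C_cov : all (vertex_cover G) [seq C i | i <- iota 0 k].
    apply/allP => X /mapP[i]; rewrite mem_iota add0n => /andP[_ lt_ik] ->.
    apply/vertex_coverP => u v uv; have := g_cov i lt_ik u v uv.
    by have := c_proper u v uv; rewrite !inE; lia.
  rewrite /= C_cov andbT.
  apply/vertex_coverP => u v uv; apply/norP => -[].
  rewrite !inE !negb_exists => /forallP uD /forallP vD.
  (* A vertex outside D whose colour is some i < k would have g i = 0, so a
     neighbour would have g i >= 2 and belong to D. *)
  have last_colour w w' : G w w' ->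
      (forall i : 'I_k, ~~ ((1 < g i w) || (c w == i) && (0 < g i w)))%N ->
      (forall i : 'I_k, ~~ ((1 < g i w') || (c w' == i) && (0 < g i w')))%N ->
      c w = k.
    move=> ww' wD w'D; apply/eqP; rewrite eqn_leq -ltnS c_lt /= leqNgt.
    apply/negP => lt_ck; have /= := wD (Ordinal lt_ck).
    have /= := w'D (Ordinal lt_ck); have := g_cov _ lt_ck _ _ ww'.
    rewrite eqxx; lia.
  have := c_proper _ _ uv; rewrite (last_colour _ _ uv uD vD).
  by rewrite (last_colour v u) ?eqxx // edge_sym.
- move=> v /=; rewrite count_map -sum1_count big_mkcond /=.
  rewrite (_ : iota 0 k = index_iota 0 k) ?big_mkord; last first.
    by rewrite /index_iota subn0.
  (* A vertex of D is charged to an index i at which C_i <= g_i is strict. *)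
  have [|_] := boolP (v \in D); last first.
    by apply: leq_sum => i _; move: (C_le i v); rewrite unfold_in /=; case: ifP.
  rewrite inE => /existsP[i Di]; rewrite (bigD1 i) // [leqRHS](bigD1 i) //=.
  rewrite addnA leq_add //; last first.
    by apply: leq_sum => j _; have := C_le j v; case: ifP => // ->.
  by rewrite inE; move: Di; case: eqP => _ /=; case: ifP => Ci; lia.
Qed.

(** Each complete group of k 2-covers yields an extra vertex cover; a leftover
    2-cover still dominates its support, which is a vertex cover. *)
Lemma two_covers_regroup k d (c : 'I_n -> nat) (g : nat -> 'I_n -> nat) :
    (0 < k)%N ->
    (forall v, c v < k.+1)%N -> (forall u v, G u v -> c u != c v) ->
    (forall i, (i < d)%N -> multicover 2 (g i)) ->
  coverable (d + d %/ k) (fun v => \sum_(i < d) g i v)%N.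
Proof.
move=> k_gt0 c_lt c_proper; elim/ltn_ind: d g => d IHd g g_cov.
have [lt_dk|le_kd] := ltnP d k.
  rewrite divn_small // addn0; elim: d {IHd lt_dk} g g_cov => [|d IHd] g g_cov.
    exact: coverable0.
  have g0_cov : coverable 1 (g 0%N).
    by apply: coverable_support => u v /(g_cov 0%N isT); exact: ltnW.
  have tail_cov := IHd (fun i => g i.+1) (fun i lt_id => g_cov i.+1 lt_id).
  rewrite -addn1 addnC; apply: coverable_le (coverableD g0_cov tail_cov) _ _ => //.
  by move=> v; rewrite big_ord_recl.
have [d' def_d] : exists d', d = (k + d')%N by exists (d - k)%N; rewrite subnKC.
subst d; have head_cov : coverable k.+1 (fun v => \sum_(i < k) g i v)%N.
  by apply: (two_covers_to_covers c_lt) => // i lt_ik; apply: g_cov; lia.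
have tail_cov : coverable (d' + d' %/ k) (fun v => \sum_(i < d') g (k + i)%N v)%N.
  by apply: (IHd _ _ (fun i => g (k + i)%N)) => [|i lt_id]; [|apply: g_cov]; lia.
apply: coverable_le (coverableD head_cov tail_cov) _ _.
  by rewrite divnDl // divnn k_gt0; lia.
by move=> v; rewrite big_split_ord.
Qed.

Lemma sum_ltn_ord d a : (\sum_(i < d) (i < a) = minn a d)%N.
Proof. by elim: d => [|d IHd]; rewrite ?big_ord0 ?big_ord_recr /= ?IHd; lia. Qed.

Lemma sum_leq_addn_ord d s a : (d <= s)%N ->
  (\sum_(i < d) (s <= a + i) = minn (a + d - s) d)%N.
Proof.
by elim: d => [|d IHd] le_ds; rewrite ?big_ord0 ?big_ord_recr /= ?IHd; lia.
Qed.

(** The splitting into 2-covers is by thresholds.  With s = 2d + e, the i-th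
    piece takes 1 at v if m v > i and another 1 if m v >= s - i; on an edge, m u <= i
    forces m v >= s - i, so each piece is a 2-cover.  For odd s, the threshold d
    itself leaves the 1-cover of the vertices with m v > d.  The values of all
    the pieces at v add up to at most m v. *)
Lemma multicover_coverable k d e m : (0 < k)%N -> colorable G k.+1 -> (e <= 1)%N ->
  multicover (2 * d + e) m -> coverable (d + d %/ k + e) m.
Proof.
move=> k_gt0 /existsP[c /forallP c_proper] e_le1 m_cov.
have h_cov : coverable e (fun v => e * (d < m v))%N.
  case: e m_cov e_le1 => [|[|//]] m_cov _; first exact: coverable0.
  by apply: coverable_support => u v /m_cov; lia.
pose g i v : nat := ((i < m v) + (2 * d + e <= m v + i))%N.
have g_cov i : (i < d)%N -> multicover 2 (g i).
  by move=> lt_id u v /m_cov; rewrite /g; lia.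
have gs_cov : coverable (d + d %/ k) (fun v => \sum_(i < d) g i v)%N.
  apply: (@two_covers_regroup k d (fun v => c v : nat)) => // u v uv.
  by have /forallP/(_ v)/implyP/(_ uv) := c_proper u.
apply: coverable_le (coverableD gs_cov h_cov) _ _ => // v.
rewrite big_split /= sum_ltn_ord sum_leq_addn_ord; last by lia.
by case: e e_le1 {m_cov h_cov g g_cov gs_cov} => [|[|//]] _; lia.
Qed.

End Covers.

Local Open Scope classical_set_scope.

(** * Generated ideals *)

Section IdealGeneration.
Variable A : comNzRingType.
Implicit Types (S Q I : set A) (f g a : A).

Lemma ideal_gen_incl S f : S f -> ideal_gen S f.
Proof.
by move=> Sf; exists 1%N, (fun=> 1), (fun=> f); rewrite big_ord1 mul1r.
Qed.

Lemma ideal_genD S f g : ideal_gen S f -> ideal_gen S g -> ideal_gen S (f + g).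
Proof.
move=> [k1 [a1 [g1 [Sg1 ->]]]] [k2 [a2 [g2 [Sg2 ->]]]].
pose glue (h1 : 'I_k1 -> A) (h2 : 'I_k2 -> A) (i : 'I_(k1 + k2)) :=
  match fintype.split i with inl j => h1 j | inr j => h2 j end.
exists (k1 + k2)%N, (glue a1 a2), (glue g1 g2); split.
  by move=> i; rewrite /glue; case: fintype.split.
rewrite big_split_ord; congr (_ + _); apply: eq_bigr => i _; rewrite /glue.
  by rewrite (unsplitK (inl i)).
by rewrite (unsplitK (inr i)).
Qed.

Lemma ideal_genM S a f : ideal_gen S f -> ideal_gen S (a * f).
Proof.
move=> [k [b [g [Sg ->]]]]; exists k, (fun i => a * b i), g; split=> //.
by rewrite mulr_sumr; apply: eq_bigr => i _; rewrite mulrA.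
Qed.

Lemma ideal_gen0 S : ideal_gen S 0.
Proof.
have no_index i : S ((fun j : 'I_0 => 0) i) by case: i.
by exists 0%N, (fun=> 0), (fun=> 0); rewrite big_ord0.
Qed.

Lemma ideal_gen_min S Q :
    Q 0 -> (forall f g, Q f -> Q g -> Q (f + g)) ->
    (forall a f, Q f -> Q (a * f)) -> S `<=` Q ->
  ideal_gen S `<=` Q.
Proof.
move=> Q0 QD QM SQ f [k [a [g [Sg ->]]]].
by apply: (big_ind Q) => // i _; apply/QM/SQ.
Qed.

Lemma ideal_exp_closed I t :
  [/\ ideal_exp I t 0,
      forall f g, ideal_exp I t f -> ideal_exp I t g -> ideal_exp I t (f + g)
    & forall a f, ideal_exp I t f -> ideal_exp I t (a * f)].
Proof.
case: t => [|t]; split=> //; first exact: ideal_gen0.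
  by move=> f g; apply: ideal_genD.
by move=> a f; apply: ideal_genM.
Qed.

Lemma prime_idealP I : prime_ideal I <->
  [/\ I 0, ~ I 1, forall a f g, I f -> I g -> I (a * f + g)
    & forall f g, I (f * g) -> I f \/ I g].
Proof.
have inI (x : A) : reflect (I x) (x \in (mem I : {pred A})).
  by apply: (iffP idP) => [/set_mem|/mem_set].
split=> [[[I0 I1 ID] IM]|[I0 I1 ID IM]].
  split=> [|/inI|a f g /inI If /inI Ig|f g /inI/IM/orP[]/inI]; first exact/inI.
  - exact/negP.
  - exact/inI/ID.
  - by left.
  - by right.
split; last by move=> f g /inI/IM[]/inI fI; apply/orP; [left | right].
split; [exact/inI | by apply/negP => /inI | ].
by move=> a f g /inI If /inI Ig; exact/inI/ID.
Qed.

End IdealGeneration.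

(** * Sets of polynomials cut out by their monomials *)

Section MonomialSets.
Variables (n : nat) (K : fieldType).
Implicit Types (U : ('I_n -> nat) -> Prop) (f g : {mpoly K[n]}).

Definition monomial_set U : set {mpoly K[n]} :=
  [set f | forall m, m \in msupp f -> U m].

Lemma monomial_set0 U : monomial_set U 0.
Proof. by move=> m; rewrite msupp0. Qed.

Lemma monomial_setD U f g :
  monomial_set U f -> monomial_set U g -> monomial_set U (f + g).
Proof. by move=> Uf Ug m /msuppD_le; rewrite mem_cat => /orP[/Uf|/Ug]. Qed.

Lemma monomial_set_mul (U1 U2 U : ('I_n -> nat) -> Prop) f g :
    (forall m1 m2 : 'X_{1..n}, U1 m1 -> U2 m2 -> U (m1 + m2)%MM) ->
  monomial_set U1 f -> monomial_set U2 g -> monomial_set U (f * g).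
Proof.
move=> U12 U1f U2g m /msuppM_le/allpairsP[[m1 m2] [/= m1f m2g ->]].
by apply: U12; [apply: U1f | apply: U2g].
Qed.

Lemma monomial_setM U a f :
    (forall m1 m2 : 'X_{1..n}, U m2 -> U (m1 + m2)%MM) ->
  monomial_set U f -> monomial_set U (a * f).
Proof.
move=> U_up Uf; apply: (@monomial_set_mul (fun=> True) U) => // m1 m2 _.
exact: U_up.
Qed.

Lemma monomial_setX U (m : 'X_{1..n}) : U m -> monomial_set U 'X_[m].
Proof. by move=> Um m'; rewrite msuppX inE => /eqP ->. Qed.

End MonomialSets.

(** * Monomial valuations *)

(** A polynomial with nonzero constant term cannot raise the order of vanishing
    at 0: the lowest surviving coefficient of the product is a product of two
    nonzero elements. *)
Lemma low_coef_cancel (D : idomainType) (p q : {poly D}) s : q`_0 != 0 ->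
  (forall d, (d < s)%N -> (q * p)`_d = 0) -> forall d, (d < s)%N -> p`_d = 0.
Proof.
move=> q0 qp0; elim/ltn_ind => d IHd lt_ds; have := qp0 d lt_ds.
rewrite coefM big_ord_recl subn0 big1 ?addr0 => [/eqP|i _].
  by rewrite mulf_eq0 (negbTE q0) => /eqP.
have lt_di : (d - lift ord0 i < d)%N.
  by rewrite lift0 ltn_subrL (leq_ltn_trans _ (ltn_ord i)).
by rewrite (IHd _ lt_di (ltn_trans lt_di lt_ds)) mulr0.
Qed.

Section Weights.
Variables (n : nat) (K : fieldType) (e : 'I_n -> nat).
Implicit Types (f g : {mpoly K[n]}) (m : 'X_{1..n}).

Definition weight m : nat := (\sum_i e i * m i)%N.

(** The substitution x_i |-> x_i T^(e i), a ring morphism; the coefficient of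
    T^d is the part of f of weight d. *)
Definition graded f : {poly {mpoly K[n]}} :=
  mmap (polyC \o @mpolyC n K) (fun i => ('X_i)%:P * 'X^(e i)) f.

Lemma mcoeff_graded f d m : ((graded f)`_d)@_m = f@_m *+ (weight m == d).
Proof.
have mmap1_graded m' : mmap1 (fun i => ('X_i)%:P * 'X^(e i)) m' =
    ('X_[m'])%:P * 'X^(weight m') :> {poly {mpoly K[n]}}.
  rewrite /mmap1 mpolyXE_id rmorph_prod /weight -prodrXr -big_split /=.
  by apply: eq_bigr => i _; rewrite exprMn -exprM rmorphXn.
rewrite /graded /mmap coef_sum raddf_sum /=.
under eq_bigr => m' _.
  rewrite mmap1_graded mulrA -polyCM coefCM coefXn mulr_natr raddfMn /=.
  rewrite mcoeffCM mcoeffX [d == _]eq_sym; over.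
have [mf|mNf] := boolP (m \in msupp f); last first.
  rewrite (memN_msupp_eq0 mNf) mul0rn big_seq big1 // => m' m'f.
  have /negbTE -> : m' != m by apply: contraNneq mNf => <-.
  by rewrite mulr0 mul0rn.
rewrite (bigD1_seq m) ?msupp_uniq //= eqxx mulr1 big1 ?addr0 // => m' /negbTE ->.
by rewrite mulr0 mul0rn.
Qed.

(** The lowest weight of a monomial is a valuation.  Transport along [graded]
    turns it into the order of vanishing at T = 0 over the integral domain of
    polynomials. *)
Lemma weight_mul_cancel s f g :
    (forall m, m \in msupp (g * f) -> (s <= weight m)%N) ->
    (exists2 m, m \in msupp g & weight m = 0%N) ->
  forall m, m \in msupp f -> (s <= weight m)%N.
Proof.
move=> gf_s [m0 m0g wt_m0].
have g0 : (graded g)`_0 != 0.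
  apply: contraTneq m0g => /(congr1 (mcoeff m0)).
  by rewrite mcoeff_graded wt_m0 eqxx mcoeff0 mulr1n mcoeff_msupp => ->; rewrite eqxx.
have gf0 d : (d < s)%N -> (graded g * graded f)`_d = 0.
  move=> lt_ds; rewrite /graded -rmorphM; apply/mpolyP => m; rewrite mcoeff0.
  rewrite mcoeff_graded; have [wt_m|] := eqVneq; last by rewrite mulr0n.
  rewrite mulr1n; apply/eqP; rewrite mcoeff_eq0; apply/negP => /gf_s.
  by rewrite wt_m leqNgt lt_ds.
have f0 := low_coef_cancel g0 gf0.
move=> m mf; rewrite leqNgt; apply/negP => /f0/(congr1 (mcoeff m)).
rewrite mcoeff_graded eqxx mcoeff0 mulr1n; apply/eqP.
by rewrite -mcoeff_msupp.
Qed.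

End Weights.

(** * Ordinary and symbolic powers of the cover ideal *)

Section CoverIdeal.
Variables (n : nat) (G : sgraph n) (K : fieldType).
Implicit Types (f g : {mpoly K[n]}) (C : {set 'I_n}) (s t : nat).
Local Notation J := (cover_ideal G K).

Definition cover_monomial C : 'X_{1..n} := [multinom (v \in C : nat) | v < n].

Lemma cover_monomialE C :
  \prod_(v in C) 'X_v = 'X_[cover_monomial C] :> {mpoly K[n]}.
Proof.
rewrite mpolyXE_id big_mkcond; apply: eq_bigr => v _.
by rewrite mnmE; case: (v \in C).
Qed.

Lemma coverable_up t (m1 m2 : 'X_{1..n}) :
  coverable G t m2 -> coverable G t (m1 + m2)%MM.
Proof. by move=> /coverable_le; apply=> // v; rewrite mnmDE leq_addl. Qed.

Lemma cover_ideal_exp_sub t : ideal_exp J t `<=` monomial_set (coverable G t).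
Proof.
elim: t => [|t IHt]; first by move=> f _ m _; apply: coverable0.
apply: ideal_gen_min; first exact: monomial_set0.
- exact: monomial_setD.
- by move=> a f; apply: monomial_setM => m1 m2; apply: coverable_up.
move=> _ [g [h [Jg Jh ->]]].
apply: (@monomial_set_mul _ _ (coverable G 1)) (IHt _ Jh)
  => [m1 m2 m1_cov m2_cov|].
  by apply: coverable_le (coverableD m1_cov m2_cov) _ _ => // v; rewrite mnmDE.
apply: ideal_gen_min Jg => [||a f|_ [C covC ->]]; first exact: monomial_set0.
- exact: monomial_setD.
- by apply: monomial_setM => m1 m2; apply: coverable_up.
rewrite cover_monomialE; apply: monomial_setX; exists [:: C].
by split=> /= [||v] //; rewrite ?covC // mnmE addn0.
Qed.

Lemma coverable_ideal_exp t (m : 'X_{1..n}) :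
  coverable G t m -> ideal_exp J t 'X_[m].
Proof.
elim: t m => [//|t IHt] m [[|C Cs] []] // [szCs] /andP[covC covCs] leCs.
have C_le v : ((v \in C) <= m v)%N by apply: leq_trans (leCs v); apply: leq_addr.
have -> : m = (cover_monomial C + (m - cover_monomial C))%MM.
  by apply/mnmP => v; rewrite mnmDE mnmBE mnmE subnKC.
rewrite mpolyXD; apply: ideal_gen_incl.
exists 'X_[cover_monomial C], 'X_[m - cover_monomial C].
split=> //; first by apply: ideal_gen_incl; exists C; rewrite ?cover_monomialE.
by apply: IHt; exists Cs; split=> // v; rewrite mnmBE mnmE; have /= := leCs v; lia.
Qed.

Lemma cover_ideal_expE t : ideal_exp J t = monomial_set (coverable G t).
Proof.
apply/seteqP; split; first exact: cover_ideal_exp_sub.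
move=> f f_cov; have [J0 JD JM] := ideal_exp_closed J t.
rewrite [f]mpolyE big_seq; apply: (big_ind (ideal_exp J t)) => // m mf.
by rewrite -mul_mpolyC; apply/JM/coverable_ideal_exp/f_cov.
Qed.

Lemma cover_ideal_exp1 : ideal_exp J 1 = J.
Proof.
apply/seteqP; split=> [|f Jf].
  apply: ideal_gen_min; [exact: ideal_gen0 | exact: ideal_genD | exact: ideal_genM |].
  by move=> _ [g [h [Jg _ ->]]]; rewrite mulrC; apply: ideal_genM.
by apply: ideal_gen_incl; exists f, 1; rewrite mulr1.
Qed.

Lemma cover_idealE : J = monomial_set (multicover G 1).
Proof.
rewrite -cover_ideal_exp1 cover_ideal_expE; apply/seteqP; split=> f f_cov m /f_cov.
  move=> [[|C [|? ?]] []] // _ /andP[/vertex_coverP covC _] leC u v /covC.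
  by have /= := leC u; have /= := leC v; lia.
exact: coverable_support.
Qed.

(** For u != v this is the s-th power of (x_u, x_v), described by its monomials
    rather than by generators. *)
Definition edge_ideal_power u v s : set {mpoly K[n]} :=
  monomial_set (fun m => s <= m u + m v)%N.

Local Notation edge_ideal u v := (edge_ideal_power u v 1).

Lemma edge_weightE u v (m : 'X_{1..n}) :
  weight (fun i => (i == u) + (i == v))%N m = (m u + m v)%N.
Proof.
rewrite /weight; under eq_bigr => i _ do rewrite mulnDl.
rewrite big_split /=; congr (_ + _)%N.
  by rewrite (bigD1 u) //= eqxx mul1n big1 ?addn0 // => i /negbTE ->.
by rewrite (bigD1 v) //= eqxx mul1n big1 ?addn0 // => i /negbTE ->.
Qed.

Lemma notin_edge_ideal u v f : ~ edge_ideal u v f ->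
  exists2 m : 'X_{1..n}, m \in msupp f & m u = 0%N /\ m v = 0%N.
Proof.
move=> Nf; apply: contrapT => no_m; apply: Nf => m mf; rewrite lt0n.
by apply/eqP => m0; apply: no_m; exists m => //; lia.
Qed.

(** The ideals (x_u, x_v)^s are primary: this one fact yields primality of
    (x_u, x_v), the identification of the associated primes, and the passage from
    a localization back to the polynomial ring. *)
Lemma edge_ideal_power_cancel u v s f g :
  edge_ideal_power u v s (g * f) -> ~ edge_ideal u v g -> edge_ideal_power u v s f.
Proof.
move=> gf_s /notin_edge_ideal[m0 m0g [m0u m0v]] m mf.
rewrite -edge_weightE; apply: (@weight_mul_cancel _ _ _ s f g) => // [m' /gf_s|].
  by rewrite edge_weightE.
by exists m0; rewrite // edge_weightE m0u m0v.
Qed.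

Lemma edge_ideal_powerM u v s a f :
  edge_ideal_power u v s f -> edge_ideal_power u v s (a * f).
Proof. by apply: monomial_setM => m1 m2; rewrite !mnmDE; lia. Qed.

Lemma edge_ideal_prime u v : prime_ideal (edge_ideal u v).
Proof.
apply/prime_idealP; split; first exact: monomial_set0.
- by move=> /(_ 0%MM); rewrite msupp1 inE eqxx !mnm0E => /(_ isT).
- by move=> a f g uf ug; apply: monomial_setD ug; apply: edge_ideal_powerM.
move=> f g fg; case: (pselect (edge_ideal u v f)) => [|Nf]; [by left | right].
exact: edge_ideal_power_cancel fg Nf.
Qed.

Lemma vertex_cover_setC1 v : vertex_cover G (finset.setC [set v]%SET).
Proof.
apply/vertex_coverP => x y xy; rewrite !inE -negb_and.
by apply: contraTN xy => /andP[/eqP-> /eqP->]; rewrite edge_irrefl.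
Qed.

(** Locally at the edge uv the cover ideal is all of (x_u, x_v): once the other
    exponents are large, the complements of u and of v are covers enough. *)
Lemma edge_coverable u v s (m : 'I_n -> nat) : (s <= m u + m v)%N ->
  (forall w, w != u -> w != v -> (s <= m w)%N) -> coverable G s m.
Proof.
move=> s_uv s_w; pose a := minn (m u) s.
exists (nseq a (finset.setC [set v]%SET) ++ nseq (s - a) (finset.setC [set u]%SET)).
split; first by rewrite size_cat !size_nseq; lia.
  by rewrite all_cat !all_nseq !vertex_cover_setC1 !orbT.
move=> w; rewrite count_cat !count_nseq !inE.
case: (eqVneq w v) => [->|wv]; case: (eqVneq _ u) => [wu|wu] /=.
- by lia.
- by lia.
- by rewrite wu; lia.
- by have := s_w w wu wv; lia.
Qed.

(** It is invertible in the localization at (x_u, x_v); with s = 1 it is also the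
    element whose annihilator modulo the cover ideal is (x_u, x_v). *)
Definition outside_monomial u v s : 'X_{1..n} :=
  [multinom if (w == u) || (w == v) then 0%N else s | w < n].

Lemma outside_notin_edge_ideal u v s : ~ edge_ideal u v 'X_[outside_monomial u v s].
Proof.
by move/(_ (outside_monomial u v s)); rewrite msuppX inE eqxx !mnmE !eqxx orbT => /(_ isT).
Qed.

Lemma cover_ideal_sub_edge u v s : G u v -> ideal_exp J s `<=` edge_ideal_power u v s.
Proof.
move=> uv; rewrite cover_ideal_expE => f f_cov m /f_cov [Cs [<- covCs leCs]].
apply: leq_trans (leq_add (leCs u) (leCs v)).
elim: Cs covCs {leCs} => //= C Cs IHCs /andP[/vertex_coverP/(_ u v uv)].
by move=> Cuv /IHCs; lia.
Qed.

Lemma edge_ideal_associated u v : G u v -> associated_prime J (edge_ideal u v).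
Proof.
move=> uv; split; first exact: edge_ideal_prime.
exists 'X_[outside_monomial u v 1]; apply/seteqP; split=> g.
  move=> uvg; rewrite /= cover_idealE => m /msuppM_le/allpairsP[[m1 m2] [/= m1g]].
  rewrite msuppX inE => /eqP-> -> x y; have := uvg _ m1g; rewrite !mnmDE !mnmE.
  case: ifPn => [/orP[]/eqP->|_]; last by lia.
    by case: ifPn => [/orP[]/eqP->|_]; rewrite ?edge_irrefl //; lia.
  by case: ifPn => [/orP[]/eqP->|_]; rewrite ?edge_irrefl //; lia.
move=> J_g; apply: edge_ideal_power_cancel (@outside_notin_edge_ideal u v 1).
rewrite mulrC; apply: (cover_ideal_sub_edge uv); rewrite cover_ideal_expE => m.
by rewrite /= cover_idealE in J_g; move/J_g/coverable_support.
Qed.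

Lemma symbolic_power_sub s : symbolic_power J s `<=` monomial_set (multicover G s).
Proof.
move=> f f_symb m mf u v uv.
have [a [b [c [Ja Nb Nc def_a]]]] := f_symb _ (edge_ideal_associated uv).
suff uv_f : edge_ideal_power u v s f by apply: uv_f.
apply: edge_ideal_power_cancel Nb; apply: edge_ideal_power_cancel Nc.
by rewrite def_a; apply/edge_ideal_powerM/(cover_ideal_sub_edge uv).
Qed.

(** A prime P = (J : f) is proper, so f is outside J, hence outside the ideal of
    some edge; cancelling f from J <= (x_u, x_v) puts P inside that edge ideal.
    Whatever lies outside that edge ideal may then serve as a denominator at P. *)
Lemma associated_prime_sub_edge P : associated_prime J P ->
  exists u v, G u v /\ P `<=` edge_ideal u v.
Proof.
move=> [/prime_idealP[_ P1 _ _] [f defP]].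
have [uv_f|] := pselect (forall u v, G u v -> edge_ideal u v f).
  case: P1; rewrite defP /= mul1r cover_idealE => m mf u v uv.
  exact: uv_f uv m mf.
move=> /existsNP[u /existsNP[v /not_implyP[uv Nf]]]; exists u, v; split=> // g.
rewrite defP => Jgf; apply: edge_ideal_power_cancel Nf; rewrite mulrC.
by have := @cover_ideal_sub_edge u v 1 uv; rewrite cover_ideal_exp1; apply.
Qed.

Lemma monomial_symbolic_power s (m : 'X_{1..n}) :
  multicover G s m -> symbolic_power J s 'X_[m].
Proof.
move=> m_cov P /associated_prime_sub_edge[u [v [uv P_uv]]].
exists ('X_[outside_monomial u v s] * 'X_[m]), 'X_[outside_monomial u v s], 1.
split=> //; last 2 first.
- by move/P_uv; apply: outside_notin_edge_ideal.
- by move/P_uv => /(_ 0%MM); rewrite msupp1 inE eqxx !mnm0E => /(_ isT).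
rewrite -mpolyXD; apply: coverable_ideal_exp; apply: (@edge_coverable u v).
  by rewrite !mnmDE; have := m_cov u v uv; lia.
by move=> w wu wv; rewrite mnmDE mnmE (negbTE wu) (negbTE wv) leq_addr.
Qed.

(** The dictionary between containments of ideals and combinatorics. *)
Lemma symbolic_power_subP s t : symbolic_power J s `<=` ideal_exp J t <->
  (forall m : 'X_{1..n}, multicover G s m -> coverable G t m).
Proof.
rewrite cover_ideal_expE; split=> [sub m m_cov|cov f /symbolic_power_sub f_cov m /f_cov].
  by apply: (sub _ (monomial_symbolic_power m_cov)); rewrite msuppX mem_head.
exact: cov.
Qed.

End CoverIdeal.

(** * Containments and bounds on the resurgence *)

Section ResurgenceBounds.
Variables (n : nat) (G : sgraph n) (K : fieldType).
Local Notation J := (cover_ideal G K).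
Local Notation chi := (chromatic_number G).

Lemma chromatic_gt1 u v : G u v -> (1 < chi)%N.
Proof.
rewrite /chromatic_number; case: ex_minnP => k /existsP[c c_proper] _ uv.
have /forallP/(_ u)/forallP/(_ v)/implyP/(_ uv) := c_proper.
case: k c {c_proper} => [|[|//]] c; first by case: (c u).
by rewrite !ord1 eqxx.
Qed.

(** Both containments of the theorem and the bound on the resurgence are
    instances of this count, for suitable d, e and t. *)
Lemma chromatic_containment u v d e t : G u v -> (e <= 1)%N ->
  (t <= d + d %/ chi.-1 + e)%N -> symbolic_power J (2 * d + e) `<=` ideal_exp J t.
Proof.
move=> uv e_le1 t_le; apply/symbolic_power_subP => m m_cov.
have chi_gt1 := chromatic_gt1 uv.
apply: coverable_le t_le (fun=> leqnn _); apply: multicover_coverable => //.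
  by rewrite -ltnS prednK // ltnW.
rewrite prednK ?(ltnW chi_gt1) //.
by rewrite /chromatic_number; case: ex_minnP.
Qed.

(** Complements of vertex covers are independent, so t vertex covers put at
    least t (#|S| - b) units of weight on S, where only N #|S| are available. *)
Lemma not_coverable_balanced (S : {set 'I_n}) b N t :
    (forall I, is_independent G I -> (#|I :&: S| <= b)%N) ->
    (N * #|S| < t * (#|S| - b))%N ->
  ~ coverable G t (fun v => if v \in S then N else 2 * N)%N.
Proof.
move=> S_indep lt_N [Cs [szCs covCs leCs]].
move: lt_N; apply/negP; rewrite -leqNgt.
apply: (@leq_trans (\sum_(v in S) count (fun C : {set 'I_n} => v \in C) Cs)%N); last first.
  rewrite mulnC -sum_nat_const; apply: leq_sum => v vS.
  by apply: leq_trans (leCs v) _; rewrite vS.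
rewrite -{t}szCs; elim: Cs covCs {leCs} => //= C Cs IHCs /andP[covC /IHCs le_Cs].
rewrite mulSn big_split leq_add //= {le_Cs IHCs}.
have : (#|finset.setC C :&: S| <= b)%N.
  apply: S_indep; apply/forall_inP => x xC; apply/forall_inP => y yC.
  apply/negP => /(vertex_coverP _ _ covC); move: xC yC; rewrite !inE.
  by move=> /negbTE-> /negbTE->.
have -> : (\sum_(v in S) (v \in C) = #|S :&: C|)%N.
  rewrite -sum1_card big_mkcond [RHS]big_mkcond; apply: eq_bigr => v _.
  by rewrite inE; case: (v \in S); case: (v \in C).
by rewrite finset.setIC -finset.setDE -(cardsID C S); lia.
Qed.

(** With w = #|S|, the ratio 2 ((w - b) M - 1) / (w M) tends to 2 - 2b/w as M
    grows; subtracting 1 makes the counting inequality strict. *)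
Lemma asymptotic_resurgence_ge (R : realType) (S : {set 'I_n}) b :
    (forall I, is_independent G I -> (#|I :&: S| <= b)%N) -> (b < #|S|)%N ->
  ((2 - 2 * b%:R / #|S|%:R : R)%:E <= asymptotic_resurgence R J)%E.
Proof.
move=> S_indep lt_bS; set w := #|S| in lt_bS *.
have w_gt0 : 0 < w%:R :> R by rewrite ltr0n; lia.
apply/lee_addgt0Pr => eps eps_gt0.
(* M > 2 / eps makes the error 2 / (w M) at most eps; M >= 2 keeps the
   numerator positive. *)
pose M := (Num.truncn (2 / eps)).+2.
have M_gt : 2 / eps < M%:R.
  by apply: lt_trans (truncnS_gt _) _; rewrite ltr_nat.
have N_gt0 : (0 < (w - b) * M - 1)%N by rewrite subn_gt0; nia.
apply: (@le_trans _ _ (((2 * ((w - b) * M - 1))%N%:R / (w * M)%N%:R)%:E + eps%:E)%E).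
  rewrite lee_fin !natrM natrB ?natrM ?natrB; [|lia|nia].
  set W := w%:R in w_gt0 *; set B := b%:R; have M_gt0 : 0 < M%:R :> R by rewrite ltr0n.
  have -> : 2 * ((W - B) * M%:R - 1) / (W * M%:R) = 2 - 2 * B / W - 2 / (W * M%:R).
    by field; rewrite !gt_eqF.
  suff : 2 / (W * M%:R) <= eps by lra.
  rewrite ler_pdivrMr ?mulr_gt0 //.
  have W_ge1 : 1 <= W by rewrite ler1n; lia.
  move: M_gt; rewrite ltr_pdivrMr // => /ltW/le_trans; apply.
  by rewrite mulrC ler_pM2l // ler_peMl // ltW.
apply: leeD2r; apply: ereal_sup_ubound.
exists (2 * ((w - b) * M - 1))%N, (w * M)%N; split=> //; [by lia | by rewrite /M; nia |].
exists 1%N => r r_gt0 /symbolic_power_subP sub.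
pose N := (((w - b) * M - 1) * r)%N.
have := @not_coverable_balanced S b N (w * M * r) S_indep.
case; first by rewrite -/w /N; nia.
suff cov : coverable G (w * M * r) [multinom if v \in S then N else 2 * N | v < n]%N.
  by apply: coverable_le cov _ _ => // v; rewrite mnmE.
by apply: sub => u v _; rewrite !mnmE -mulnA -/N; case: ifP; case: ifP; lia.
Qed.

(** If J^(sr) fails to lie in J^(tr) for all large r, one such r > 0 already
    exhibits the ratio s/t = (sr)/(tr) in the set defining the resurgence. *)
Lemma asymptotic_resurgence_le (R : realType) :
  (asymptotic_resurgence R J <= resurgence R J)%E.
Proof.
apply: le_ereal_sup => _ [s [t [s_gt0 t_gt0 [r0 Nsub] ->]]].
have r_gt0 : (0 < maxn r0 1)%N by rewrite leq_max orbT.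
exists (s * maxn r0 1)%N, (t * maxn r0 1)%N; split; rewrite ?muln_gt0 ?s_gt0 ?t_gt0 //.
  by apply: Nsub; rewrite leq_max leqnn.
have r_neq0 : (maxn r0 1)%:R != 0 :> R by rewrite pnatr_eq0 -lt0n.
by rewrite !natrM -mulf_div divff // mulr1.
Qed.

Lemma resurgence_le (R : realType) u v : G u v ->
  (resurgence R J <= (2 - 2 / chi%:R : R)%:E)%E.
Proof.
move=> uv; have chi_gt1 := chromatic_gt1 uv.
apply: ge_ereal_sup => _ [s [t [s_gt0 t_gt0 Nsub ->]]].
have chi_gt0 : 0 < chi%:R :> R by rewrite ltr0n ltnW.
have s_chi : (s * chi <= 2 * chi.-1 * t)%N.
  rewrite leqNgt; apply/negP => lt_s; apply: Nsub.
  have def_s : s = (2 * s./2 + odd s)%N by rewrite -{1}(odd_double_half s); lia.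
  rewrite def_s; apply: (chromatic_containment uv); first exact: leq_b1.
  have : (t - s./2 - odd s <= s./2 %/ chi.-1)%N.
    rewrite leq_divRL ?ltn_predRL //.
    rewrite -(prednK (ltnW chi_gt1)) in lt_s; move: lt_s (chi_gt1).
    by rewrite {1}def_s -ltn_predRL; move: chi.-1 (odd s) => k e; nia.
  by lia.
rewrite lee_fin ler_pdivrMr ?ltr0n // -(ler_pM2r chi_gt0) -natrM.
have -> : (2 - 2 / chi%:R) * t%:R * chi%:R = (2 * chi.-1 * t)%N%:R :> R.
  rewrite !natrM -subn1 natrB ?(ltnW chi_gt1) //.
  by field; rewrite gt_eqF.
by rewrite ler_nat.
Qed.

Lemma independence_bound I : is_independent G I -> (#|I| <= independence_number G)%N.
Proof. by move=> indI; apply: leq_bigmax_cond. Qed.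

Lemma independence_number_lt u v : G u v -> (independence_number G < n)%N.
Proof.
move=> uv; have n_gt0 : (0 < n)%N by apply: leq_ltn_trans (ltn_ord u).
rewrite -[ltnRHS](prednK n_gt0) ltnS; apply/bigmax_leqP => I indI.
rewrite -ltnS (prednK n_gt0) -[ltnRHS]card_ord -cardsT; apply: proper_card.
rewrite properT; apply: contraL uv => /eqP def_I.
have /forall_inP/(_ u) := indI; rewrite def_I inE => /(_ isT)/forall_inP/(_ v).
by rewrite inE => /(_ isT).
Qed.

Lemma clique_number_attained :
  exists2 C : {set 'I_n}, is_clique G C & #|C| = clique_number G.
Proof.
have clique0 : is_clique G finset.set0 by apply/forall_inP => x; rewrite inE.
have clique_gt0 : (0 < #|is_clique G|)%N by apply/card_gt0P; exists finset.set0.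
have [C C_clique szC] := eq_bigmax_cond (fun C : {set 'I_n} => #|C|) clique_gt0.
by exists C.
Qed.

Lemma clique_number_gt1 u v : G u v -> (1 < clique_number G)%N.
Proof.
move=> uv; have uv_neq : u != v by apply: contraTneq uv => ->; rewrite edge_irrefl.
have <- : #|[set u; v]%SET| = 2%N by rewrite cards2 uv_neq.
apply: (@leq_bigmax_cond _ (is_clique G) (fun C : {set 'I_n} => #|C|)).
apply/forall_inP => x; rewrite !inE => /orP[]/eqP->; apply/forall_inP => y;
  by rewrite !inE => /orP[]/eqP->; rewrite ?eqxx ?uv ?implybT // edge_sym uv implybT.
Qed.

Lemma clique_independent (C I : {set 'I_n}) :
  is_clique G C -> is_independent G I -> (#|I :&: C| <= 1)%N.
Proof.
move=> /forall_inP C_clique /forall_inP I_indep; apply/card_le1_eqP => x y.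
rewrite !inE => /andP[xI xC] /andP[yI yC]; apply/eqP.
have /forall_inP/(_ y yI) := I_indep x xI; apply: contraNT => yx.
by have /forall_inP/(_ y yC)/implyP := C_clique x xC; apply; rewrite eq_sym.
Qed.

End ResurgenceBounds.

Theorem theorem1p2 (R : realType) (K : fieldType) (n : nat) (G : sgraph n)
    (G_noiso : no_isolated_vertex G) (G_conn : connected_graph G) :
  [/\ forall c : nat, (0 < c)%N ->
        forall r : nat, (c * chromatic_number G <= r)%N ->
          symbolic_power (cover_ideal G K) (2 * r - 2 * c)%N
            `<=` ideal_exp (cover_ideal G K) r,
      forall c : nat, (0 < c)%N ->
        forall r : nat, (c * chromatic_number G + 1 <= r)%N ->
          symbolic_power (cover_ideal G K) (2 * r - 2 * c - 1)%N
            `<=` ideal_exp (cover_ideal G K) r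
    & [/\ ((Num.max (2 - 2 / (clique_number G)%:R)
                    (2 - 2 * (independence_number G)%:R / n%:R) : R)%:E
             <= asymptotic_resurgence R (cover_ideal G K))%E,
          (asymptotic_resurgence R (cover_ideal G K)
             <= resurgence R (cover_ideal G K))%E
        & (resurgence R (cover_ideal G K)
             <= (2 - 2 / (chromatic_number G)%:R : R)%:E)%E]].
Proof.
have [u [v uv]] : exists u v, G u v.
  by have [n_gt0 _] := G_conn; exists (Ordinal n_gt0); apply: G_noiso.
have chi_gt1 := chromatic_gt1 uv.
have chi1_gt0 : (0 < (chromatic_number G).-1)%N by rewrite ltn_predRL.
have c_le c d : (c * (chromatic_number G).-1 <= d)%N ->
    (c <= d %/ (chromatic_number G).-1)%N by rewrite leq_divRL.
split.
- move=> c c_gt0 r le_r; have -> : (2 * r - 2 * c = 2 * (r - c) + 0)%N by lia.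
  apply: (chromatic_containment uv) => //.
  have := c_le c (r - c)%N; rewrite -(prednK (ltnW chi_gt1)) in le_r *.
  nia.
- move=> c c_gt0 r le_r.
  have -> : (2 * r - 2 * c - 1 = 2 * (r - c - 1) + 1)%N by nia.
  apply: (chromatic_containment uv) => //.
  have := c_le c (r - c - 1)%N; rewrite -(prednK (ltnW chi_gt1)) in le_r *.
  nia.
split; [|exact: asymptotic_resurgence_le|exact: resurgence_le uv].
have [C C_clique szC] := clique_number_attained G.
rewrite maxEge; case: ifP => _.
  have := @asymptotic_resurgence_ge _ G K R C 1; rewrite szC mulr1; apply.
    by move=> I; apply: clique_independent.
  exact: clique_number_gt1 uv.
have := @asymptotic_resurgence_ge _ G K R [set: 'I_n]%SET (independence_number G).
rewrite cardsT card_ord; apply; last exact: independence_number_lt uv.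
by move=> I; rewrite finset.setIT; apply: independence_bound.
Qed.
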